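(* Let $q>2$ and let $\mathfrak{g}=\mathfrak{g}_1\oplus\bigoplus_{i\ge q}\mathfrak{g}_i$ be an infinite-dimensional $\mathbb{N}$-graded Lie algebra of maximal class generated by nonzero graded components $\mathfrak{g}_1$ and $\mathfrak{g}_q$, and let $\mathfrak{g}_{q+2}\neq\{0\}$. If $$[\mathfrak{g}_q,\mathfrak{g}_{q+1}]=[\mathfrak{g}_{q+1},\mathfrak{g}_{q+2}]=\dots=[\mathfrak{g}_{2q},\mathfrak{g}_{2q+1}]=0,$$ then $\mathfrak{g}\cong\mathfrak{m}_0^q$.
   Context: All Lie algebras are over an algebraically closed field $F$ of characteristic zero. For a Lie algebra $\mathfrak{g}$ with lower central series $\mathfrak{g}^1=\mathfrak{g}\supseteq\mathfrak{g}^2\supseteq\cdots$, $\mathfrak{g}$ is residually nilpotent if $\bigcap_i\mathfrak{g}^i=0$; a residually nilpotent Lie algebra is of maximal class if $\sum_{i\ge1}(\dim\mathfrak{g}^i/\mathfrak{g}^{i+1}-1)=1$. $\mathfrak{m}_0^q$ is the Lie algebra with basis $e_1,e_q,e_{q+1},e_{q+2},\dots$ and brackets $[e_1,e_i]=e_{i+1}$ for $i\ge q$, all other brackets of basis elements (not following by skew-symmetry) being zero. *)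

(* Defs.v *)
From HB Require Import structures.
From mathcomp Require Import all_boot all_order all_algebra.
From mathcomp Require Import boolp classical_sets.

Set Implicit Arguments.
Unset Strict Implicit.
Unset Printing Implicit Defensive.

Import GRing.Theory.
Local Open Scope ring_scope.
Local Open Scope classical_set_scope.

HB.mixin Record isLieAlgebra (F : fieldType) V of GRing.Lmodule F V := {
  lie : V -> V -> V;
  lie_linearl : forall (a : F) (x y z : V),
    lie (a *: x + y) z = a *: lie x z + lie y z;
  lie_linearr : forall (a : F) (x y z : V),
    lie z (a *: x + y) = a *: lie z x + lie z y;
  liexx : forall x : V, lie x x = 0;
  lie_jacobi : forall x y z : V,
    lie x (lie y z) + lie y (lie z x) + lie z (lie x y) = 0
}.

#[short(type="lieAlgType")]
HB.structure Definition LieAlgebra (F : fieldType) :=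
  { V of GRing.Lmodule F V & isLieAlgebra F V }.

Section Subspaces.
Variables (F : fieldType) (V : lmodType F).

Definition subspace (A : set V) : Prop :=
  A 0 /\ forall (a : F) (x y : V), A x -> A y -> A (a *: x + y).

Definition lspan (A : set V) : set V := smallest subspace A.

Definition infinite_dimensional : Prop :=
  forall s : seq V, lspan [set` s] <> setT.

(* For subspaces B `<=` A: dim (A / B) = n, witnessed by n vectors of A that
   form a basis of A modulo B. *)
Definition quotient_dim (A B : set V) (n : nat) : Prop :=
  exists v : 'I_n -> V,
    [/\ forall i, A (v i),
        forall x, A x -> exists c : 'I_n -> F, B (x - \sum_i c i *: v i)
      & forall c : 'I_n -> F, B (\sum_i c i *: v i) -> forall i, c i = 0].

(* V is the internal direct sum of the subspaces G i. *)
Definition direct_sum (G : nat -> set V) : Prop :=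
  [/\ forall i, subspace (G i),
      forall x, exists (n : nat) (u : nat -> V),
        (forall i, G i (u i)) /\ x = \sum_(i < n) u i
    & forall (n : nat) (u : nat -> V),
        (forall i, G i (u i)) -> \sum_(i < n) u i = 0 ->
        forall i, (i < n)%N -> u i = 0].

End Subspaces.

Arguments infinite_dimensional {F} V.

Section LieNotions.
Variables (F : fieldType) (g : lieAlgType F).

Definition lie_prod (A B : set g) : set g :=
  lspan [set lie x y | x in A & y in B].

Definition lie_subalgebra (A : set g) : Prop :=
  subspace A /\ forall x y, A x -> A y -> A (lie x y).

Definition lie_generated (A : set g) : set g := smallest lie_subalgebra A.

(* Indices are shifted by one: [lcs n] is the term g^{n+1}, so that
   [lcs 0] = g^1 = g. *)
Fixpoint lcs (n : nat) : set g :=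
  if n is m.+1 then lie_prod setT (lcs m) else setT.

Definition residually_nilpotent : Prop :=
  \bigcap_(n in [set: nat]) lcs n = [set 0].

(* A series of integers has sum 1 when its partial sums are eventually 1;
   in particular all the quotients are required to be finite-dimensional. *)
Definition maximal_class : Prop :=
  residually_nilpotent /\
  exists d : nat -> nat,
    (forall n, quotient_dim (lcs n) (lcs n.+1) (d n)) /\
    (exists N, forall n, (N <= n)%N -> \sum_(i < n) ((d i)%:Z - 1) = 1).

(* The grading is by the positive integers. *)
Definition Ngrading (gr : nat -> set g) : Prop :=
  [/\ direct_sum gr,
      gr 0%N = [set 0]
    & forall i j, lie_prod (gr i) (gr j) `<=` gr (i + j)%N].

End LieNotions.

Arguments lcs {F} g n.
Arguments residually_nilpotent {F} g.
Arguments maximal_class {F} g.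

(* A graded isomorphism is a Lie algebra isomorphism carrying the component of
   each degree onto the component of the same degree. *)
Definition graded_lie_iso (F : fieldType) (g h : lieAlgType F)
    (gr : nat -> set g) (hr : nat -> set h) : Prop :=
  exists phi : {linear g -> h},
    [/\ bijective phi,
        forall x y, phi (lie x y) = lie (phi x) (phi y)
      & forall i, phi @` gr i = hr i].

(* Model of m_0^q on F x F[X]: the basis is e_1 = (1, 0) and
   e_i = (0, X^{i-q}) for i >= q, so that ad e_1 is multiplication by X on the
   second factor.  The bracket does not involve q, which only enters through
   the labels of the basis vectors, i.e. through the grading. *)
Definition m0 (F : fieldType) (q : nat) : Type := (F^o * {poly F})%type.

Section M0.
Variables (F : fieldType) (q : nat).

HB.instance Definition _ := GRing.Lmodule.copy (m0 F q) (F^o * {poly F})%type.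

Definition m0_lie (x y : m0 F q) : m0 F q :=
  (0, 'X * (x.1 *: y.2 - y.1 *: x.2)).

Fact m0_lie_linearl (a : F) (x y z : m0 F q) :
  m0_lie (a *: x + y) z = a *: m0_lie x z + m0_lie y z.
Proof.
congr pair => /=; first by rewrite scaler0 addr0.
by rewrite scalerAr -mulrDr; congr (_ * _);
  rewrite scalerDl scalerDr scalerBr !scalerA (mulrC z.1) opprD addrACA.
Qed.

Fact m0_liexx (x : m0 F q) : m0_lie x x = 0.
Proof. by rewrite /m0_lie subrr mulr0. Qed.

Fact m0_lieC (x y : m0 F q) : m0_lie x y = - m0_lie y x.
Proof. by congr pair => /=; rewrite ?oppr0 // -mulrN opprB. Qed.

Fact m0_lie_linearr (a : F) (x y z : m0 F q) :
  m0_lie z (a *: x + y) = a *: m0_lie z x + m0_lie z y.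
Proof. by rewrite m0_lieC m0_lie_linearl opprD -scalerN -!m0_lieC. Qed.

Fact m0_jacobi (x y z : m0 F q) :
  m0_lie x (m0_lie y z) + m0_lie y (m0_lie z x) + m0_lie z (m0_lie x y) = 0.
Proof.
congr pair => /=; first by rewrite !addr0.
rewrite !scale0r !subr0 -!mulrDr !scalerAr -!mulrDr !scalerBr !scalerA.
rewrite (mulrC y.1 x.1) (mulrC z.1 x.1) (mulrC z.1 y.1).
have cyc (a b c : {poly F}) : (a - b) + (c - a) + (b - c) = 0.
  by rewrite (addrC (a - b)) !addrA !subrK subrr.
by rewrite cyc !mulr0.
Qed.

HB.instance Definition _ := isLieAlgebra.Build F (m0 F q)
  m0_lie_linearl m0_lie_linearr m0_liexx m0_jacobi.

(* Only meant for i = 1 and i >= q. *)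
Definition m0_e (i : nat) : m0 F q :=
  if i == 1%N then (1, 0) else (0, 'X^(i - q)).

Definition m0_gr (i : nat) : set (m0 F q) :=
  if (i == 1%N) || (q <= i)%N then lspan [set m0_e i] else [set 0].

Hypothesis q_gt1 : (1 < q)%N.

Lemma m0_eE i : (q <= i)%N -> m0_e i = (0, 'X^(i - q)).
Proof. by rewrite /m0_e; case: eqP => // -> /(leq_trans q_gt1). Qed.

Lemma m0_lie_e1 i : (q <= i)%N -> lie (m0_e 1) (m0_e i) = m0_e i.+1.
Proof.
move=> qi; rewrite (m0_eE qi) (m0_eE (leqW qi)) subSn // exprS.
by congr pair; rewrite /= scale1r scale0r subr0.
Qed.

Lemma m0_lie_e i j : (q <= i)%N -> (q <= j)%N -> lie (m0_e i) (m0_e j) = 0.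
Proof.
move=> qi qj; rewrite !m0_eE //.
by congr pair; rewrite /= !scale0r subr0 mulr0.
Qed.

Lemma m0_comb (a : F) (n : nat) (c : nat -> F) :
  a *: m0_e 1 + \sum_(i < n) c i *: m0_e (q + i) = (a, \poly_(i < n) c i).
Proof.
have -> : \sum_(i < n) c i *: m0_e (q + i) = (0, \poly_(i < n) c i) :> m0 F q.
  rewrite poly_def; elim: n => [|n IH]; first by rewrite !big_ord0.
  rewrite !big_ord_recr /= IH m0_eE ?leq_addr // addKn.
  by congr pair; rewrite /= scaler0 addr0.
by congr pair; rewrite /= ?scaler0 ?add0r // addr0 [a *: _]mulr1.
Qed.

Lemma m0_e_span (x : m0 F q) : exists (a : F) (n : nat) (c : nat -> F),
  x = a *: m0_e 1 + \sum_(i < n) c i *: m0_e (q + i).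
Proof.
exists x.1, (size x.2), (fun i => x.2`_i).
by rewrite m0_comb coefK; case: x.
Qed.

Lemma m0_e_free (a : F) (n : nat) (c : nat -> F) :
  a *: m0_e 1 + \sum_(i < n) c i *: m0_e (q + i) = 0 ->
  a = 0 /\ forall i, (i < n)%N -> c i = 0.
Proof.
rewrite m0_comb => -[-> /polyP c0]; split=> // i lt_in.
by have := c0 i; rewrite coef_poly lt_in coef0.
Qed.

End M0.

(* Main.v *)
(* Write x and y for generators of g_1 and g_q and f_i = (ad x)^i y, of degree
   q + i.  Since g is infinite-dimensional of maximal class and g_1, g_q both
   survive in g / g^2, all the quotients g^n / g^(n+1) with n > 1 are lines.
   Hence as long as f_(i-q+1) is nonzero, [y, f_(i-q)] lies one step deeper in the
   lower central series than its weight suggests, where only brackets with x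
   reach its degree; so g_(q+i) is spanned by f_i.  If some f_i vanished, g would
   be finite-dimensional.

   It remains to show that [f_i, f_j] = c(i, j) f_(q+i+j) is zero.  Let b = c(0, -)
   and let M be minimal with b(M) nonzero; the hypothesis gives M >= 2q.  The
   Jacobi identity on f_i, f_j, f_l with i + j = M and l < q forces c(l, q + M) = 0,
   hence b(M + q) = ... = b(M + 2q - 1) = 0.  By skew-symmetry
   b(m) = - sum_j (-1)^j C(m, j) b(j), so the polynomial
   sum_(M <= j < M + q) (-1)^j b(j) C(m, j), of degree less than M + q in m, has the
   M + q roots 0, ..., M - 1, M + q, ..., M + 2q - 1; therefore b(M) = 0. *)

Require Import Defs.
From HB Require Import structures.
From mathcomp Require Import all_boot all_order all_algebra.
From mathcomp Require Import boolp classical_sets.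
From mathcomp Require Import zify ring.

Set Implicit Arguments.
Unset Strict Implicit.
Unset Printing Implicit Defensive.

Import Order.TTheory GRing.Theory Num.Theory.
Local Open Scope ring_scope.
Local Open Scope classical_set_scope.

(** * Vanishing of the structure constants of the brackets [[f_i, f_j]] *)

Section StructureConstants.
Variables (F : fieldType) (q : nat) (c : nat -> nat -> F).
Hypotheses (F_char0 : [pchar F] =i pred0) (q_gt0 : (0 < q)%N).
Hypothesis c_alt : forall i, c i i = 0.
Hypothesis c_anti : forall i j, c i j = - c j i.
(** The derivation rule for [ad x], in coordinates along [f_(q+i+j+1)]. *)
Hypothesis c_rec : forall i j, c i j = c i.+1 j + c i j.+1.
Hypothesis c_jacobi : forall i j l,
  c i j * c (q + i + j)%N l + c j l * c (q + j + l)%N i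
    + c l i * c (q + l + i)%N j = 0.
Hypothesis c_near_diag : forall i, (i <= q)%N -> c i i.+1 = 0.

Lemma sc_recl i j : c i.+1 j = c i j - c i j.+1.
Proof. by rewrite (c_rec i j) addrK. Qed.

Lemma sc_recr i j : c i j.+1 = c i j - c i.+1 j.
Proof. by rewrite (c_rec i j) addrC addKr. Qed.

(** Each row is the previous one minus its shift, so row [k] is [(1 - shift)^k] applied to row [0];
    the induction step is Pascal's rule. *)
Lemma sc_row0 k m : c k m = \sum_(j < k.+1) (-1) ^+ j * 'C(k, j)%:R * c 0 (m + j).
Proof.
elim: k m => [|k IH] m; first by rewrite big_ord1 expr0 bin0 !mul1r addn0.
rewrite sc_recl !IH [RHS]big_ord_recl [X in X + _]big_ord_recl !bin0 -addrA.
congr (_ + _); rewrite [RHS]big_ord_recr /= [X in _ - X]big_ord_recr /=.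
rewrite opprD addrA -sumrB; congr (_ + _); last first.
  by rewrite /bump /= add1n !binn addnS addSn exprS; ring.
apply: eq_bigr => i _; rewrite /bump /= add1n binS natrD exprS addSnnS; ring.
Qed.

(** When antidiagonal [n - 1] vanishes, [c_rec] makes the entries of antidiagonal [n] alternate in
    sign; a single zero then kills all of them. *)
Lemma sc_skew n : (forall i j, (i + j < n)%N -> c i j = 0) ->
  forall i j, (i + j)%N = n -> c i j = (-1) ^+ i * c 0 n.
Proof.
move=> c0; elim=> [|i IH] j; first by rewrite add0n mul1r => ->.
move=> ijn; rewrite sc_recl c0 ?sub0r; last by lia.
by rewrite IH ?exprS ?mulN1r ?mulNr //; lia.
Qed.

(** Induction on antidiagonals: the middle entry vanishes, by [c_alt] if [n] is even and by
    [c_near_diag] if [n] is odd, and [sc_skew] spreads this zero. *)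
Lemma sc_low n : (n < 2 * q)%N -> forall i j, (i + j)%N = n -> c i j = 0.
Proof.
elim/ltn_ind: n => n IH lt_n i j ijn.
have c0 i' j' : (i' + j' < n)%N -> c i' j' = 0 by move=> h; apply: (IH _ h); lia.
have sk := sc_skew c0.
suff c0n : c 0 n = 0 by rewrite (sk i j) // c0n mulr0.
have [r [s [rsn crs]]] : exists r s, (r + s)%N = n /\ c r s = 0.
  case: (boolP (odd n)) => n_odd.
    by exists n./2, n./2.+1; split; [lia | apply: c_near_diag; lia].
  by exists n./2, n./2; split; [lia | apply: c_alt].
by move: crs; rewrite (sk r s rsn) => /eqP; rewrite mulf_eq0 signr_eq0 => /eqP.
Qed.

(* The sum is a polynomial in [m] of degree less than [n], which vanishes at the
   [n] points [0, .., M - 1, n, .., 2 n - M - 1]. *)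
Lemma binomial_transform_eq0 (M n : nat) (b : nat -> F) : (M < n)%N ->
  (forall j, (j < M)%N -> b j = 0) ->
  (forall m, (n <= m < n + (n - M))%N ->
     \sum_(j < n) 'C(m, j)%:R * b j = 0) ->
  b M = 0.
Proof.
move=> Mn b0 bC.
have natF := (pcharf0P F).1 F_char0.
(* Newton's form: the [j]-th product divided by [j!] takes the value ['C(m, j)] at [m]. *)
pose P : {poly F} := \sum_(j < n) (b j / (j`!)%:R) *: \prod_(i < j) ('X - i%:R%:P).
have PE m : P.[m%:R] = \sum_(j < n) 'C(m, j)%:R * b j.
  rewrite horner_sum; apply: eq_bigr => j _; rewrite hornerZ horner_prod.
  have -> : \prod_(i < j) ('X - i%:R%:P).[m%:R] = (m ^_ j)%:R :> F.
    rewrite ffact_prod natr_prod.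
    case: (leqP j m) => jm.
      apply: eq_bigr => i _; rewrite hornerXsubC natrB //.
      by apply: leq_trans jm; apply: ltnW.
    (* For [m < j] subtraction in [nat] truncates, so the products are not compared factor by
       factor; in both, the factor of index [m] is zero. *)
    rewrite (bigD1 (Ordinal jm)) //= hornerXsubC subrr mul0r.
    by rewrite (bigD1 (Ordinal jm)) //= subnn mul0r.
  rewrite -bin_ffact natrM; field.
  by rewrite natF -lt0n fact_gt0.
have szP : (size P <= n)%N.
  apply: (leq_trans (size_sum _ _ _)); apply/bigmax_leqP => j _.
  apply: (leq_trans (size_scale_leq _ _)).
  by rewrite size_prod_XsubC /index_enum -enumT size_enum_ord.
pose rs := [seq (i%:R : F) | i <- iota 0 M ++ iota n (n - M)].
have rootsP : all (root P) rs.
  apply/allP => x /mapP[m m_in ->]; rewrite mem_cat !mem_iota in m_in.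
  rewrite /root PE; case: (ltnP m M) => mM; last first.
    by rewrite bC //; move: m_in; lia.
  rewrite big1 // => j _; case: (ltnP j M) => jM; first by rewrite b0 ?mulr0.
  by rewrite bin_small ?mul0r //; lia.
(* Distinct naturals stay distinct in [F] by characteristic zero. *)
have uniq_rs : uniq rs.
  rewrite map_inj_uniq; last first.
    move=> i j /eqP; wlog ij : i j / (i <= j)%N => [W|].
      by case/orP: (leq_total i j) => h; [|rewrite eq_sym => E; apply/esym; move: E]; apply: W.
    rewrite eq_sym -subr_eq0 -natrB // natF; lia.
  rewrite cat_uniq !iota_uniq andbT; apply/hasPn => m; rewrite !mem_iota; lia.
have P0 : P = 0.
  apply/eqP; apply: contraTT szP => Pn0.
  have := max_poly_roots Pn0 rootsP uniq_rs.
  by rewrite -ltnNge size_map size_cat !size_iota => h; apply: leq_ltn_trans h; lia.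
(* At [M] only the term [j = M] survives: [b] kills the smaller [j], the binomial coefficient the
   larger ones. *)
have := PE M; rewrite P0 horner0 (bigD1 (Ordinal Mn)) //= binn mul1r big1 ?addr0 //.
move=> j; rewrite -val_eqE /= => jM; case: (ltnP j M) => h; first by rewrite b0 ?mulr0.
by rewrite bin_small ?mul0r //; lia.
Qed.

Lemma structure_constants_eq0 i j : c i j = 0.
Proof.
suff row0 m : c 0 m = 0.
  by rewrite sc_row0 big1 // => k _; rewrite row0 mulr0.
apply/eqP/negPn/negP => cm.
have ex : exists m, c 0 m != 0 by exists m.
case: (ex_minnP ex) => M cM minM.
have row_low k : (k < M)%N -> c 0 k = 0.
  by move=> kM; apply/eqP; apply: contraTT kM => /minM; rewrite -leqNgt.
have low k l : (k + l < M)%N -> c k l = 0.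
  move=> klM; rewrite sc_row0 big1 // => a _; rewrite row_low ?mulr0 //.
  by have := ltn_ord a; lia.
have M_ge : (2 * q <= M)%N.
  rewrite leqNgt; apply/negP => /sc_low/(_ 0 M erefl) cM0.
  by rewrite cM0 eqxx in cM.
have colw l : (l < q)%N -> c l (q + M)%N = 0.
  (* With this triple the last two products have a factor below antidiagonal [M], the third one
     because [2l + 1 < 2q <= M]; the first product is [c (q + M) l] up to the nonzero factor
     [(-1)^(l+1) c 0 M]. *)
  move=> lq; have := c_jacobi l.+1 (M - l.+1) l.
  rewrite (low (M - l.+1)%N l); last by lia.
  rewrite (low l l.+1); last by lia.
  rewrite !mul0r !addr0 (sc_skew low); last by lia.
  have -> : (q + l.+1 + (M - l.+1))%N = (q + M)%N by lia.
  move/eqP; rewrite !mulf_eq0 signr_eq0 (negbTE cM) /= c_anti oppr_eq0.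
  by rewrite c_anti oppr_eq0 c_anti => /eqP ->; rewrite oppr0.
(* The recursion carries the zeros of column [q + M] over a triangle, whose edge [k = 0] gives
   [row_high]. *)
have tri a k : (k + a < q)%N -> c k (q + M + a)%N = 0.
  elim: a k => [|a IH] k kq; first by rewrite addn0 colw //; lia.
  by rewrite addnS sc_recr !IH ?subrr //; lia.
have row_high a : (a < q)%N -> c 0 (M + q + a) = 0.
  by move=> aq; rewrite (addnC M) tri.
case/eqP: cM.
have : (-1) ^+ M * c 0 M = 0; last first.
  by move/eqP; rewrite mulf_eq0 signr_eq0 => /eqP.
apply: (@binomial_transform_eq0 M (M + q) (fun j => (-1) ^+ j * c 0 j)).
- by lia.
- by move=> k /row_low ->; rewrite mulr0.
(* The required sum is the expansion of [c k 0 = - c 0 k] by [sc_row0]: its terms of index at least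
   [M + q] vanish by [row_high], and so does [c 0 k]. *)
move=> k k_in; have : c k 0 = 0.
  rewrite c_anti (_ : k = (M + q + (k - (M + q)))%N); last by lia.
  by rewrite row_high ?oppr0 //; lia.
rewrite sc_row0 -(big_mkord xpredT (fun j => (-1) ^+ j * 'C(k, j)%:R * c 0 (0 + j))).
rewrite (big_cat_nat (n := M + q)) //=; [|by lia].
rewrite [X in _ + X]big_nat [X in _ + X]big1 ?addr0; last first.
  move=> a /andP[a_ge a_le]; rewrite (_ : (0 + a)%N = (M + q + (a - (M + q)))%N); last by lia.
  by rewrite row_high ?mulr0 //; lia.
rewrite big_mkord => {2}<-; apply: eq_bigr => a _.
by rewrite add0n mulrA (mulrC 'C(_, _)%:R).
Qed.

End StructureConstants.

(** * Linear algebra of subspaces and quotients *)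

Section SubspaceTheory.
Variables (F : fieldType) (V : lmodType F).
Implicit Types (A B : set V) (s : seq V).

Lemma subspace0 A : subspace A -> A 0. Proof. by case. Qed.

Lemma subspaceZ A a x : subspace A -> A x -> A (a *: x).
Proof. by case=> A0 Al Ax; rewrite -[_ *: _]addr0; apply: Al. Qed.

Lemma subspaceD A x y : subspace A -> A x -> A y -> A (x + y).
Proof. by case=> _ Al Ax Ay; rewrite -[x]scale1r; apply: Al. Qed.

Lemma subspaceN A x : subspace A -> A x -> A (- x).
Proof. by move=> sA Ax; rewrite -scaleN1r; apply: subspaceZ. Qed.

Lemma subspaceB A x y : subspace A -> A x -> A y -> A (x - y).
Proof. by move=> sA Ax Ay; apply: subspaceD => //; apply: subspaceN. Qed.

Lemma subspace_sum A (I : Type) (r : seq I) (P : pred I) (f : I -> V) :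
  subspace A -> (forall i, P i -> A (f i)) -> A (\sum_(i <- r | P i) f i).
Proof.
move=> sA Af; apply: big_ind => //; first exact: subspace0.
by move=> x y; apply: subspaceD.
Qed.

Lemma lspan_subspace A : subspace (lspan A).
Proof.
split=> [B [sB _]|a x y Ax Ay B sAB]; first exact: subspace0.
by case: (sAB) => -[_ Bl] _; apply: Bl; [apply: Ax | apply: Ay].
Qed.

Lemma subset_lspan A : A `<=` lspan A.
Proof. exact: sub_smallest. Qed.

Lemma lspan_sub A B : subspace B -> A `<=` B -> lspan A `<=` B.
Proof. by move=> sB AB; apply: smallest_sub. Qed.

Lemma lspan_subset A B : A `<=` B -> lspan A `<=` lspan B.
Proof.
by move=> AB; apply: lspan_sub; [apply: lspan_subspace|move=> x /AB/subset_lspan].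
Qed.

Lemma lspan1E (v : V) : lspan [set v] = [set x | exists a, x = a *: v].
Proof.
apply/seteqP; split=> [|_ [a ->]]; last first.
  by apply: (subspaceZ _ (lspan_subspace _)); apply: subset_lspan.
apply: lspan_sub => [|_ ->]; last by exists 1; rewrite scale1r.
split; first by exists 0; rewrite scale0r.
by move=> a _ _ [b ->] [c ->]; exists (a * b + c); rewrite scalerDl scalerA.
Qed.

(** Modulo [B] the [v i] have coordinates forming a [k] by [n] matrix; as [n < k], a nonzero row
    vector in its kernel provides the coefficients. *)
Lemma quotient_dim_dep A B n k (v : 'I_k -> V) :
  subspace B -> quotient_dim A B n -> (forall i, A (v i)) -> (n < k)%N ->
  exists2 a : 'I_k -> F, exists i, a i != 0 & B (\sum_i a i *: v i).
Proof.
move=> sB [w [_ wgen _]] Av lt_nk.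
have /choice[c cP] : forall i, exists c : 'I_n -> F, B (v i - \sum_j c j *: w j).
  by move=> i; apply: wgen.
pose M := \matrix_(i < k, j < n) c i j.
have /rowV0Pn[a /sub_kermxP aM a0] : kermx M != 0.
  by rewrite -mxrank_eq0 mxrank_ker -lt0n subn_gt0; apply: leq_ltn_trans lt_nk; apply: rank_leq_col.
exists (a 0); first by apply/rV0Pn.
have -> : \sum_i a 0 i *: v i = \sum_i a 0 i *: (v i - \sum_j c i j *: w j).
  under [RHS]eq_bigr do rewrite scalerBr scaler_sumr.
  rewrite sumrB exchange_big /= [X in _ - X]big1 ?subr0 // => j _.
  under eq_bigr do rewrite scalerA.
  rewrite -scaler_suml; move/rowP/(_ j): aM; rewrite !mxE => aM.
  by under eq_bigr do rewrite -[c _ _](mxE matrix_key (fun i j => c i j)); rewrite aM scale0r.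
by apply: (subspace_sum _ sB) => i _; apply: subspaceZ.
Qed.

End SubspaceTheory.

(** * Lie brackets and the lower central series *)

Section LieTheory.
Variables (F : fieldType) (g : lieAlgType F).
Implicit Types (x y z : g) (A B : set g).

Lemma lieDl x y z : lie (x + y) z = lie x z + lie y z.
Proof. by have := lie_linearl 1 x y z; rewrite !scale1r. Qed.

Lemma lieDr z x y : lie z (x + y) = lie z x + lie z y.
Proof. by have := lie_linearr 1 x y z; rewrite !scale1r. Qed.

Lemma lie0l z : lie 0 z = 0.
Proof. by apply: (addrI (lie 0 z)); rewrite -lieDl !addr0. Qed.

Lemma lie0r z : lie z 0 = 0.
Proof. by apply: (addrI (lie z 0)); rewrite -lieDr !addr0. Qed.

Lemma lieZl a x z : lie (a *: x) z = a *: lie x z.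
Proof. by have := lie_linearl a x 0 z; rewrite lie0l !addr0. Qed.

Lemma lieZr a z x : lie z (a *: x) = a *: lie z x.
Proof. by have := lie_linearr a x 0 z; rewrite lie0r !addr0. Qed.

Lemma lieC x y : lie x y = - lie y x.
Proof.
apply/eqP; rewrite -addr_eq0; have := liexx (x + y).
by rewrite lieDl !lieDr !liexx add0r addr0 => ->.
Qed.

Lemma lieNr x y : lie x (- y) = - lie x y.
Proof. by rewrite -scaleN1r lieZr scaleN1r. Qed.

Lemma lie_leibniz x y z : lie x (lie y z) = lie (lie x y) z + lie y (lie x z).
Proof.
have /eqP := lie_jacobi x y z; rewrite -addrA addr_eq0 => /eqP ->.
by rewrite opprD addrC -(lieC _ z) (lieC z x) lieNr opprK.
Qed.

Lemma lie_suml (I : Type) (r : seq I) (P : pred I) (f : I -> g) z :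
  lie (\sum_(i <- r | P i) f i) z = \sum_(i <- r | P i) lie (f i) z.
Proof. by apply: (big_morph (fun x => lie x z)) => [x y|]; rewrite ?lieDl ?lie0l. Qed.

Lemma lie_sumr (I : Type) (r : seq I) (P : pred I) (f : I -> g) z :
  lie z (\sum_(i <- r | P i) f i) = \sum_(i <- r | P i) lie z (f i).
Proof. by apply: (big_morph (lie z)) => [x y|]; rewrite ?lieDr ?lie0r. Qed.

Lemma mem_lie_prod A B x y : A x -> B y -> lie_prod A B (lie x y).
Proof. by move=> Ax By; apply: subset_lspan; exists x => //; exists y. Qed.

Lemma lie_prod_sub A B C : subspace C ->
  (forall x y, A x -> B y -> C (lie x y)) -> lie_prod A B `<=` C.
Proof. by move=> sC ABC; apply: lspan_sub => // _ [x Ax [y By <-]]; apply: ABC. Qed.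

Lemma lcs_subspace n : subspace (lcs g n).
Proof. by case: n => [|n] //; apply: lspan_subspace. Qed.

Lemma lcsS n : lcs g n.+1 `<=` lcs g n.
Proof.
elim: n => [|n IH] //; apply: lie_prod_sub; first exact: lcs_subspace.
by move=> x y _ /IH; apply: mem_lie_prod.
Qed.

Lemma lcs_le m n : (m <= n)%N -> lcs g n `<=` lcs g m.
Proof.
elim: n => [|n IH]; first by rewrite leqn0 => /eqP ->.
rewrite leq_eqVlt => /orP[/eqP -> //|/IH]; exact: subset_trans (@lcsS n).
Qed.

(* By the Jacobi identity, the elements whose adjoint action preserves [W] form a
   subalgebra. *)
Lemma generated_ind A W : lie_generated A = [set: g] -> subspace W ->
  A `<=` W -> (forall x y, A x -> W y -> W (lie x y)) -> W = [set: g].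
Proof.
move=> genA sW AW stabW.
have WI x y : W y -> W (lie x y).
  move=> Wy; have : [set: g] x by [].
  rewrite -genA => /(_ [set x | forall y, W y -> W (lie x y)]).
  apply=> //; split; last by move=> u Au v; apply: stabW.
  split=> [|u v Nu Nv w Ww /=].
    split=> [v _|a u v Nu Nv w Ww] /=; first by rewrite lie0l; apply: subspace0.
    rewrite lieDl lieZl; apply: subspaceD => //; last exact: Nv.
    by apply: subspaceZ => //; apply: Nu.
  have -> : lie (lie u v) w = lie u (lie v w) - lie v (lie u w).
    by rewrite (lie_leibniz u v w) addrK.
  by apply: subspaceB => //; [apply: Nu; apply: Nv | apply: Nv; apply: Nu].
apply/seteqP; split=> // x; rewrite -genA; apply; split=> //.
by split=> // u v _; apply: WI.
Qed.

(** No term of the series defining maximal class is negative, as a zero quotient would make [g]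
    finite-dimensional; [u] and [v] make the first term at least [1]. Since the sum is [1], the
    first term is [1] and the others are [0]. *)
Lemma maximal_class_dims : infinite_dimensional g -> maximal_class g ->
  forall u v : g,
  (forall a b, lcs g 1 (a *: u + b *: v) -> a = 0 /\ b = 0) ->
  quotient_dim (lcs g 0) (lcs g 1) 2 /\
  forall n, quotient_dim (lcs g n.+1) (lcs g n.+2) 1.
Proof.
move=> infg [resg [d [dP [N dN]]]] u v uv.
have d_gt0 n : (0 < d n)%N.
  rewrite lt0n; apply/eqP => dn0; apply: contrapT => _.
  (* A zero quotient makes the series constant from [n] on, hence zero there by residual
     nilpotence. *)
  have stat m : (n <= m)%N -> lcs g n `<=` lcs g m.
    elim: m => [|m IH] nm; first by move: nm; rewrite leqn0 => /eqP ->.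
    have [->//|n_m] := eqVneq n m.+1.
    have {n_m}nm : (n <= m)%N by lia.
    have lm : lcs g m = lcs g n.
      by apply/seteqP; split; [apply: lcs_le | apply: IH].
    rewrite /= lm -[X in _ `<=` X]/(lcs g n.+1) => x nx.
    case: (dP n) => w [_ /(_ x nx)[c]]; rewrite big1 ?subr0 //.
    by move=> i; have := ltn_ord i; rewrite [X in (_ < X)%N]dn0.
  have n0 : lcs g n `<=` [set 0].
    move=> x nx; rewrite -resg => m _.
    have [/stat|/ltnW/lcs_le] := leqP n m; exact.
  (* Representatives of bases of the first [n] quotients span [g] modulo [lcs g n], which is
     zero. *)
  have [s sP] : exists s : seq g, forall x, exists2 y, lspan [set` s] y & lcs g n (x - y).
    elim: n {n0 stat dn0} => [|n [s sP]].
      by exists [::] => x; exists 0 => //; exact: (subspace0 (lspan_subspace _)).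
    case: (dP n) => w [_ wgen _].
    exists (s ++ [seq w i | i : 'I_(d n)]) => x.
    have [y ys /wgen[c cP]] := sP x.
    exists (y + \sum_i c i *: w i); last by rewrite opprD addrA.
    apply: (subspaceD (lspan_subspace _)).
      by apply: lspan_subset ys => z /= zs; rewrite mem_cat zs.
    apply: (subspace_sum _ (lspan_subspace _)) => i _.
    apply: (subspaceZ _ (lspan_subspace _)).
    by apply: subset_lspan => /=; rewrite mem_cat map_f ?orbT // mem_enum.
  case: (infg s); apply/seteqP; split=> // x _.
  by have [y ys /n0/eqP] := sP x; rewrite subr_eq0 => /eqP ->.
have d0_gt1 : (1 < d 0)%N.
  rewrite ltnNge; apply/negP => d0.
  have [a [i ai]] := @quotient_dim_dep _ _ _ _ _ 2 (fun i => if i == ord0 then u else v)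
    (lcs_subspace 1) (dP 0%N) (fun=> I) d0.
  rewrite big_ord_recl big_ord1 /= => /uv[a0 a1].
  case/negP: ai; move: i => [[|[|//]] i2] /=; apply/eqP.
    by rewrite -a0; congr a; apply: val_inj.
  by rewrite -a1; congr a; apply: val_inj.
have dE n : (d 0 = 2 /\ d n.+1 = 1)%N.
  (* This length is at least [N] and makes the partial sum include the index [n.+1]. *)
  have := dN (N + n.+2)%N (leq_addr _ _).
  have -> : (N + n.+2 = (N + n).+2)%N by lia.
  rewrite big_ord_recl (bigD1 (inord n)) //= /bump /= add1n inordK; last by lia.
  move=> dS; have [S S_ge0 {}dS] : exists2 S : int, 0 <= S &
      (d 0%N)%:Z - 1 + ((d n.+1)%:Z - 1 + S) = 1.
    eexists; last exact: dS.
    by apply: sumr_ge0 => i _; have := d_gt0 (1 + i)%N; lia.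
  by have := d_gt0 n.+1; lia.
split; first by have := dP 0%N; case: (dE 0%N) => ->.
by move=> n; have := dP n.+1; case: (dE n) => _ ->.
Qed.

End LieTheory.

(** * Homogeneous components in a direct sum *)

Section GradedProjection.
Variables (F : fieldType) (V : lmodType F) (gr : nat -> set V).
Hypothesis gr_sum : direct_sum gr.

Lemma gr_subspace i : subspace (gr i).
Proof. by case: gr_sum. Qed.

(** The family is cut off at its bound because [direct_sum] does not control its values beyond; this
    makes it unique. *)
Lemma graded_decomposition x : exists nu : nat * (nat -> V),
  [/\ forall i, gr i (nu.2 i), forall i, (nu.1 <= i)%N -> nu.2 i = 0
    & x = \sum_(i < nu.1) nu.2 i].
Proof.
case: gr_sum => _ /(_ x)[n [u [gu ->]]] _.
exists (n, fun i => if (i < n)%N then u i else 0); split=> /= [i|i|].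
- by case: ifP => // _; apply: subspace0 (gr_subspace i).
- by rewrite leqNgt => /negbTE ->.
- by apply: eq_bigr => i _; rewrite ltn_ord.
Qed.

(** A chosen bound on the degrees, not necessarily the least one; only the components are canonical,
    by [gr_proj_uniq]. *)
Definition gr_bound x : nat := (projT1 (cid (graded_decomposition x))).1.
Definition gr_proj i x : V := (projT1 (cid (graded_decomposition x))).2 i.

Lemma gr_proj_in i x : gr i (gr_proj i x).
Proof. by rewrite /gr_proj; case: cid => nu []. Qed.

Lemma gr_proj_bound i x : (gr_bound x <= i)%N -> gr_proj i x = 0.
Proof. by rewrite /gr_bound /gr_proj; case: cid => nu /= [_ + _]; apply. Qed.

Lemma gr_proj_sum x : x = \sum_(i < gr_bound x) gr_proj i x.
Proof. by rewrite /gr_bound /gr_proj; case: cid => nu []. Qed.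

Lemma gr_proj_uniq n (u : nat -> V) : (forall i, gr i (u i)) ->
  (forall i, (n <= i)%N -> u i = 0) ->
  forall i, gr_proj i (\sum_(j < n) u j) = u i.
Proof.
move=> gu u0 i; set x := \sum_(j < n) u j.
(* A common length for both decompositions, padded with zeros, that also covers the index [i]. *)
pose m := maxn i.+1 (maxn n (gr_bound x)).
have widen k (v : nat -> V) : (k <= m)%N -> (forall j, (k <= j)%N -> v j = 0) ->
    \sum_(j < k) v j = \sum_(j < m) v j.
  move=> km v0; rewrite (big_ord_widen _ _ km) big_mkcond /=.
  by apply: eq_bigr => j _; case: ltnP => // /v0.
case: gr_sum => _ _ /(_ m (fun j => gr_proj j x - u j)) uniq0.
apply/eqP; rewrite -subr_eq0; apply/eqP; apply: uniq0; last by rewrite leq_max leqnn.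
  by move=> j; apply: (subspaceB (gr_subspace j)) => //; apply: gr_proj_in.
rewrite sumrB -(widen n u) ?leq_max ?leqnn ?orbT //.
rewrite -(widen (gr_bound x) (gr_proj ^~ x)) ?leq_max ?leqnn ?orbT //.
  by rewrite -gr_proj_sum subrr.
by move=> j; apply: gr_proj_bound.
Qed.

Lemma gr_proj_gr i j x : gr i x -> gr_proj j x = if j == i then x else 0.
Proof.
move=> gx; pose u k := if k == i then x else 0.
have {1}-> : x = \sum_(k < i.+1) u k.
  rewrite big_ord_recr /= {2}/u eqxx big1 ?add0r // => k _.
  by rewrite /u ltn_eqF.
rewrite -[RHS]/(u j); apply: gr_proj_uniq => k; last by move=> ik; rewrite /u gtn_eqF.
by rewrite /u; case: eqP => [->//|_]; apply: subspace0 (gr_subspace k).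
Qed.

Lemma gr_projP i j x : gr i x -> i <> j -> gr_proj j x = 0.
Proof. by move=> /(gr_proj_gr j) -> ij; case: eqP => // ji; case: ij. Qed.

Lemma gr_projid i x : gr i x -> gr_proj i x = x.
Proof. by move=> /(gr_proj_gr i) ->; rewrite eqxx. Qed.

Lemma gr_proj_linear i : linear (gr_proj i).
Proof.
move=> a x y; pose n := maxn (gr_bound x) (gr_bound y).
have widen z : (gr_bound z <= n)%N -> z = \sum_(j < n) gr_proj j z.
  move=> zn; rewrite {1}(gr_proj_sum z) (big_ord_widen _ (gr_proj ^~ z) zn) big_mkcond /=.
  by apply: eq_bigr => j _; case: ltnP => // /gr_proj_bound.
have {1}-> : a *: x + y = \sum_(j < n) (a *: gr_proj j x + gr_proj j y).
  by rewrite big_split -scaler_sumr /= -!widen ?leq_maxl ?leq_maxr.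
rewrite (gr_proj_uniq (u := fun j => a *: gr_proj j x + gr_proj j y)) // => j.
  by case: (gr_subspace j) => _; apply; apply: gr_proj_in.
by rewrite geq_max => /andP[xj yj]; rewrite !gr_proj_bound // scaler0 addr0.
Qed.

HB.instance Definition _ i :=
  GRing.isLinear.Build F V V *:%R (gr_proj i) (gr_proj_linear i).

Lemma gr_proj0 i : gr_proj i 0 = 0.
Proof. exact: linear0. Qed.

Lemma gr_proj_eq0 x : (forall i, gr_proj i x = 0) -> x = 0.
Proof. by move=> x0; rewrite (gr_proj_sum x) big1. Qed.

Lemma gr_ind (W : set V) : subspace W -> (forall i, gr i `<=` W) -> W = [set: V].
Proof.
move=> sW grW; apply/seteqP; split=> // x _; rewrite (gr_proj_sum x).
by apply: (subspace_sum _ sW) => i _; apply: (grW i); apply: gr_proj_in.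
Qed.

End GradedProjection.

Lemma Ngrading_sum (F : fieldType) (g : lieAlgType F) (gr : nat -> set g) :
  Ngrading gr -> direct_sum gr.
Proof. by case. Qed.

(** * Components of brackets in a graded Lie algebra *)

Section GradedLie.
Variables (F : fieldType) (g : lieAlgType F) (gr : nat -> set g).
Hypothesis g_graded : Ngrading gr.

Let gr_sum := Ngrading_sum g_graded.
Local Notation pr := (gr_proj gr_sum).

Lemma gr_lie i j x y : gr i x -> gr j y -> gr (i + j)%N (lie x y).
Proof. by case: g_graded => _ _ grM gx gy; apply: grM; apply: mem_lie_prod. Qed.

Lemma gr_proj_lie_ind (W : set g) k x y : subspace W ->
  (forall i j, (i + j)%N = k -> W (lie (pr i x) (pr j y))) ->
  W (pr k (lie x y)).
Proof.
move=> sW WI; rewrite {1}(gr_proj_sum gr_sum x) {1}(gr_proj_sum gr_sum y).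
rewrite lie_suml linear_sum; apply: (subspace_sum _ sW) => i _.
rewrite lie_sumr linear_sum; apply: (subspace_sum _ sW) => j _.
rewrite /= (gr_proj_gr gr_sum _ (gr_lie (gr_proj_in gr_sum i x) (gr_proj_in gr_sum j y))).
by case: eqP => [/esym/WI//|_]; apply: subspace0.
Qed.

End GradedLie.

(** * The chain [f_i] and the components of [g] *)

Section NarrowAlgebra.
Variables (F : fieldType) (q : nat) (g : lieAlgType F) (gr : nat -> set g).
Hypotheses (F_char0 : [pchar F] =i pred0) (q_gt2 : (2 < q)%N).
Hypothesis g_graded : Ngrading gr.
Hypothesis g_supp : forall i : nat, i <> 1%N -> (i < q)%N -> gr i = [set 0].
Hypothesis g_infinite : infinite_dimensional g.
Hypothesis g_maxclass : maximal_class g.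
Hypothesis g_gen : lie_generated (gr 1%N `|` gr q) = [set: g].
Hypothesis gq2_neq0 : gr q.+2 <> [set 0].
Hypothesis g_comm : forall i : nat, (q <= i <= 2 * q)%N ->
  lie_prod (gr i) (gr i.+1) = [set 0].
Variables (x y : g).
Hypotheses (gx : gr 1%N x) (gy : gr q y) (x_neq0 : x != 0) (y_neq0 : y != 0).

Let gr_sum := Ngrading_sum g_graded.
Local Notation pr := (gr_proj gr_sum).

Definition chain i : g := iter i (lie x) y.
Local Notation f := chain.
Arguments chain : simpl never.

Lemma chainS i : f i.+1 = lie x (f i). Proof. by []. Qed.

Lemma gr_chain i : gr (q + i)%N (f i).
Proof.
elim: i => [|i IH]; first by rewrite addn0.
by rewrite chainS addnS -add1n; apply: gr_lie.
Qed.

Lemma lcs_chain i : lcs g i (f i).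
Proof. by elim: i => [//|i IH]; apply: mem_lie_prod. Qed.

Lemma chain_eq0_le i j : (i <= j)%N -> f i = 0 -> f j = 0.
Proof.
move=> /subnK <- fi0; elim: (j - i)%N => [//|k IH].
by rewrite addSn chainS IH lie0r.
Qed.

Lemma chain_leibniz i j :
  lie x (lie (f i) (f j)) = lie (f i.+1) (f j) + lie (f i) (f j.+1).
Proof. exact: lie_leibniz. Qed.

Lemma gr_gap i z : i <> 1%N -> (i < q)%N -> gr i z -> z = 0.
Proof. by move=> i1 iq; rewrite g_supp. Qed.

Lemma gr_proj_gap i z : i <> 1%N -> (i < q)%N -> pr i z = 0.
Proof. by move=> i1 iq; apply: (gr_gap i1 iq); apply: gr_proj_in. Qed.

Lemma subspace_zero : subspace [set (0 : g)].
Proof. by split=> // a u v /= -> ->; rewrite scaler0 addr0. Qed.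

Lemma gr_proj_ker_subspace k : subspace [set z | pr k z = 0].
Proof.
split=> /= [|a u v u0 v0]; first exact: linear0.
by rewrite linearP /= u0 v0 scaler0 addr0.
Qed.

Lemma lcs_low n z k : lcs g n.+1 z -> (k < q + n.+1)%N -> pr k z = 0.
Proof.
move=> lz kq; move: z lz; apply: lie_prod_sub; first exact: gr_proj_ker_subspace.
elim: n k kq => [|n IH] k kq u v _ lv /=;
  apply: (gr_proj_lie_ind subspace_zero) => i j ijk /=.
  (* Here [i + j = k <= q]. The only sum of two supported degrees in this range is [1 + 1 = 2], and
     then [k] itself is a gap since [q > 2]. *)
  have [ik|ik] : (i <> 1 /\ i < q)%N \/ (j <> 1 /\ j < q)%N \/ (k <> 1 /\ k < q)%N.
    by lia.
  - by case: ik => i1 iq; rewrite gr_proj_gap ?lie0l.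
  case: ik => -[h1 hq]; first by rewrite (gr_proj_gap v h1) ?lie0r.
  apply: (gr_gap h1 hq); rewrite -ijk.
  by apply: (gr_lie g_graded); apply: gr_proj_in.
have [i0|i0] := posnP i.
  by rewrite (@gr_proj_gap i) ?lie0l //; lia.
have -> : pr j v = 0; last by rewrite lie0r.
have jq : (j < q + n.+1)%N by lia.
by move: v lv; apply: lie_prod_sub; [apply: gr_proj_ker_subspace | apply: IH].
Qed.

Lemma gr_proj_xy1 a b : pr 1 (a *: x + b *: y) = a *: x.
Proof.
rewrite linearP linearZ /= (gr_projid gr_sum gx) (gr_projP gr_sum gy).
  by rewrite scaler0 addr0.
by lia.
Qed.

Lemma gr_proj_xyq a b : pr q (a *: x + b *: y) = b *: y.
Proof.
rewrite linearP linearZ /= (gr_projid gr_sum gy) (gr_projP gr_sum gx).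
  by rewrite scaler0 add0r.
by lia.
Qed.

Lemma lcs_dims : quotient_dim (lcs g 0) (lcs g 1) 2 /\
  forall n, quotient_dim (lcs g n.+1) (lcs g n.+2) 1.
Proof.
apply: (maximal_class_dims g_infinite g_maxclass (u := x) (v := y)) => a b lab.
have /eqP := lcs_low lab (k := 1%N) ltac:(lia).
have /eqP := lcs_low lab (k := q) ltac:(lia).
rewrite gr_proj_xy1 gr_proj_xyq !scaler_eq0 (negbTE x_neq0) (negbTE y_neq0) !orbF.
by move=> /eqP -> /eqP ->.
Qed.

Lemma abelianization_dep z : exists a b c : F,
  [|| a != 0, b != 0 | c != 0] /\ lcs g 1 (a *: z + (b *: x + c *: y)).
Proof.
have [a [i ai]] := @quotient_dim_dep _ _ _ _ _ 3 (fun i => nth 0 [:: z; x; y] i)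
  (lcs_subspace g 1) lcs_dims.1 (fun=> I) isT.
rewrite !big_ord_recl big_ord0 /= addr0 => labc.
exists (a ord0), (a (lift ord0 ord0)), (a (lift ord0 (lift ord0 ord0))); split=> //.
have : [|| i == ord0, i == lift ord0 ord0 | i == lift ord0 (lift ord0 ord0)].
  by case: i {ai} => -[|[|[]]].
by case/or3P => /eqP <-; rewrite ai ?orbT.
Qed.

(** By [lcs_low], [lcs g 1] has no component in degrees up to [q], so a dependency of [z, x, y]
    modulo it holds exactly in degrees [1] and [q]. *)
Lemma gr1E z : gr 1%N z -> exists a, z = a *: x.
Proof.
move=> gz; have [a [b [c [abc lz]]]] := abelianization_dep z.
have /eqP := lcs_low lz (k := q) ltac:(lia).
rewrite linearP /= (gr_projP gr_sum gz); last by lia.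
rewrite scaler0 add0r gr_proj_xyq scaler_eq0 (negbTE y_neq0) orbF => /eqP c0.
have /eqP := lcs_low lz (k := 1%N) ltac:(lia).
rewrite linearP /= (gr_projid gr_sum gz) gr_proj_xy1.
have [a0|a0] := eqVneq a 0.
  rewrite a0 scale0r add0r scaler_eq0 (negbTE x_neq0) orbF => /eqP b0.
  by move: abc; rewrite a0 b0 c0 eqxx.
rewrite addr_eq0 => /eqP az; exists (- (a^-1 * b)).
by apply: (scalerI a0); rewrite az scaleNr scalerN scalerA mulVKf.
Qed.

Lemma grqE z : gr q z -> exists a, z = a *: y.
Proof.
move=> gz; have [a [b [c [abc lz]]]] := abelianization_dep z.
have /eqP := lcs_low lz (k := 1%N) ltac:(lia).
rewrite linearP /= (gr_projP gr_sum gz); last by lia.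
rewrite scaler0 add0r gr_proj_xy1 scaler_eq0 (negbTE x_neq0) orbF => /eqP b0.
have /eqP := lcs_low lz (k := q) ltac:(lia).
rewrite linearP /= (gr_projid gr_sum gz) gr_proj_xyq.
have [a0|a0] := eqVneq a 0.
  rewrite a0 scale0r add0r scaler_eq0 (negbTE y_neq0) orbF => /eqP c0.
  by move: abc; rewrite a0 b0 c0 eqxx.
rewrite addr_eq0 => /eqP az; exists (- (a^-1 * c)).
by apply: (scalerI a0); rewrite az scaleNr scalerN scalerA mulVKf.
Qed.

(** The quotient is a line, and [f n.+1] is nonzero in it because [lcs g n.+2] has no component of
    degree [q + n + 1]. *)
Lemma lcs_chain_dep n z : f n.+1 != 0 -> lcs g n.+1 z ->
  exists a, lcs g n.+2 (z - a *: f n.+1).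
Proof.
move=> fn lz; pose v (i : 'I_2) := if i == ord0 then z else f n.+1.
have lv i : lcs g n.+1 (v i) by rewrite /v; case: ifP => // _; apply: lcs_chain.
have [a [i ai]] := quotient_dim_dep (lcs_subspace g n.+2) (lcs_dims.2 n) lv isT.
rewrite big_ord_recl big_ord1; set a0 := a ord0; set a1 := a _.
rewrite -[v ord0]/z -[v _]/(f n.+1) => laz.
have [a00|a00] := eqVneq a0 0.
  move: laz; rewrite a00 scale0r add0r => laz.
  have /eqP := lcs_low laz (k := (q + n.+1)%N) ltac:(lia).
  rewrite linearZ /= (gr_projid gr_sum (gr_chain _)) scaler_eq0 (negbTE fn) orbF => /eqP a10.
  case/negP: ai; case: i => -[|[|//]] i2; apply/eqP.
    by rewrite -a00; congr a; apply: val_inj.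
  by rewrite -a10; congr a; apply: val_inj.
exists (- (a0^-1 * a1)).
rewrite scaleNr opprK -[z]scale1r -(mulVf a00) -!scalerA -scalerDr.
exact: (subspaceZ _ (lcs_subspace g _)).
Qed.

Lemma gr_proj_lie_homog i k u w : gr i u -> pr (i + k) (lie u w) = lie u (pr k w).
Proof.
move=> gu; rewrite -[LHS](subrK (lie u (pr k w))) -[RHS]add0r; congr (_ + _).
pose W : set g := [set w | pr (i + k) (lie u w) - lie u (pr k w) = 0].
suff WT : W = [set: g] by have : W w by rewrite WT.
rewrite /W; apply: (gr_ind gr_sum) => [|j v gv] /=.
  split=> /= [|a v1 v2 v10 v20]; first by rewrite lie0r !gr_proj0 lie0r subrr.
  rewrite linearP /= !lieDr !lieZr linearP /= opprD addrACA -scalerBr v10 v20.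
  by rewrite scaler0 addr0.
rewrite (gr_proj_gr gr_sum _ gv) (gr_proj_gr gr_sum _ (gr_lie g_graded gu gv)).
by rewrite eqn_add2l; case: eqP => _; rewrite ?lie0r subrr.
Qed.

(** The elements whose component of degree [q + i + 1] has this form are a subspace stable under
    bracketing with generators; it contains the generators, whose component in that degree is
    zero. *)
Lemma gr_generated i z : gr (q + i.+1)%N z ->
  exists u v, [/\ gr (q + i)%N u, gr i.+1 v & z = lie x u + lie y v].
Proof.
move=> gz; rewrite -(gr_projid gr_sum gz).
pose W : set g := [set z | exists u v, [/\ gr (q + i)%N u, gr i.+1 v
  & pr (q + i.+1) z = lie x u + lie y v]].
have sub k := gr_subspace gr_sum k.
suff WT : W = [set: g] by have : W z by rewrite WT.
rewrite /W; apply: (generated_ind g_gen).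
- split=> /= [|a z1 z2 [u1 [v1 [gu1 gv1 z1E]]] [u2 [v2 [gu2 gv2 z2E]]]].
    exists 0, 0; split; [exact: subspace0|exact: subspace0|].
    by rewrite !lie0r gr_proj0 addr0.
  exists (a *: u1 + u2), (a *: v1 + v2); split.
  + by case: (sub (q + i)%N) => _; apply.
  + by case: (sub i.+1) => _; apply.
  by rewrite linearP /= z1E z2E !lieDr !lieZr scalerDr addrACA.
- move=> w [] gw; exists 0, 0; (split; [exact: subspace0|exact: subspace0|]);
    rewrite !lie0r addr0; apply: (gr_projP gr_sum gw); lia.
move=> u w [] gu _.
  have [a ->] := gr1E gu.
  exists (a *: pr (q + i) w), 0; split; last first.
  + rewrite lie0r addr0 lieZl linearZ lieZr /= addnS -add1n.
    by rewrite (gr_proj_lie_homog _ _ gx).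
  + exact: subspace0.
  by apply: subspaceZ => //; apply: gr_proj_in.
have [a ->] := grqE gu.
exists 0, (a *: pr i.+1 w); split; last first.
+ by rewrite lie0r add0r lieZl linearZ lieZr /= (gr_proj_lie_homog _ _ gy).
+ by apply: subspaceZ => //; apply: gr_proj_in.
exact: subspace0.
Qed.

(* [lcs n.+1] lives in degrees above [q + n], and no component of degree less than
   [q] but that of [x] can raise it to degree [2q + n]. *)
Lemma lcs_step n z : lcs g n.+2 z ->
  exists2 u, gr (q + (q + n).-1)%N u & pr (q + (q + n)) z = lie x u.
Proof.
pose W : set g := [set z | exists2 u, gr (q + (q + n).-1)%N u & z = lie x u].
have sub k := gr_subspace gr_sum k.
have sW : subspace W.
  split=> [|a _ _ [u1 gu1 ->] [u2 gu2 ->]].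
    by exists 0; [exact: subspace0|rewrite lie0r].
  exists (a *: u1 + u2); last by rewrite lieDr lieZr.
  by case: (sub (q + (q + n).-1)%N) => _; apply.
move: z; apply: (@lie_prod_sub _ _ _ _ [set z | W (pr (q + (q + n)) z)]).
  split=> [|a u v Wu Wv] /=; first by rewrite gr_proj0; apply: subspace0.
  by rewrite linearP /=; case: sW => _; apply.
move=> u v _ lv /=; apply: (gr_proj_lie_ind sW) => i j ijk.
have [jn|jn] := ltnP j (q + n.+1).
  by rewrite (lcs_low lv jn) lie0r; apply: subspace0.
have [i1|i1] := eqVneq i 1%N; last first.
  by rewrite (@gr_proj_gap i) ?lie0l; [apply: subspace0 | lia | lia].
rewrite i1; have [a ->] := gr1E (gr_proj_in gr_sum 1 u).
exists (a *: pr j v); last by rewrite lieZl lieZr.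
apply: subspaceZ => //; rewrite (_ : (q + (q + n).-1)%N = j); last by lia.
exact: gr_proj_in.
Qed.

(** Induction on [i] through [gr_generated]: [[x, u]] is handled by the induction hypothesis, and
    [[y, v]] is turned into a bracket with [x]. The bound [K + q] ensures that only [f m.+1] with
    [m < K] is required to be nonzero. *)
Lemma gr_chainE K : (forall j, (j <= K)%N -> f j != 0) ->
  forall i, (i < K + q)%N -> forall z, gr (q + i)%N z -> exists a, z = a *: f i.
Proof.
move=> fK; elim/ltn_ind => -[|i] IH iK z; first by rewrite addn0 => /grqE.
move=> /gr_generated[u [v [gu gv ->]]].
have iK' : (i < K + q)%N by lia.
have {u gu}[a ->] := IH i (ltnSn i) iK' u gu.
suff [b ->] : exists b, lie y v = b *: f i.+1.
  by exists (a + b); rewrite lieZr -chainS -scalerDl.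
have [iq|iq] := ltnP i.+1 q.
  have [i0|i0] := posnP i; last first.
    by exists 0; rewrite (gr_gap _ iq gv) ?lie0r ?scale0r //; lia.
  move: gv; rewrite i0 => /gr1E[b ->]; exists (- b).
  by rewrite lieZr lieC scaleNr scalerN.
have [m im] : exists m, i.+1 = (q + m)%N by exists (i.+1 - q)%N; lia.
move: gv; rewrite im => gv.
have [b ->] := IH m ltac:(lia) ltac:(lia) v gv.
have lyf : lcs g m.+1 (lie y (f m)) by apply: mem_lie_prod; last exact: lcs_chain.
have [d ld] := lcs_chain_dep (fK m.+1 ltac:(lia)) lyf.
have [w gw] := lcs_step ld.
have gyf : gr (q + (q + m))%N (lie y (f m)).
  by apply: gr_lie => //; apply: gr_chain.
(* In degree [2q + m] the correction [d *: f m.+1], of degree [q + m + 1], disappears, so [[y, f m]]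
   itself equals [[x, w]]. *)
rewrite linearB linearZ /= (gr_projid gr_sum gyf) (gr_projP gr_sum (gr_chain _)); last by lia.
rewrite scaler0 subr0 => yfE.
have [e we] : exists e, w = e *: f i.
  by apply: (IH i (ltnSn i) iK'); rewrite (_ : i = (q + m).-1) //; lia.
by exists (b * e); rewrite lieZr yfE we lieZr scalerA -im chainS.
Qed.

(** As [2 < q], [gr_chainE] with [K = 0] already spans degree [q + 2] by [f 2]. *)
Lemma chain2_neq0 : f 2 != 0.
Proof.
apply/eqP => f20; apply: gq2_neq0; apply/seteqP; split=> [z gz|_ ->]; last first.
  exact: subspace0 (gr_subspace gr_sum _).
have f_neq0 j : (j <= 0)%N -> f j != 0 by rewrite leqn0 => /eqP ->.
rewrite -addn2 in gz.
have [a ->] := gr_chainE f_neq0 (ltac:(lia) : (2 < 0 + q)%N) gz.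
by rewrite f20 scaler0.
Qed.

Lemma chain_lie_near_diag i : (i <= q)%N -> lie (f i) (f i.+1) = 0.
Proof.
move=> iq; have : lie_prod (gr (q + i)%N) (gr (q + i).+1) (lie (f i) (f i.+1)).
  by apply: mem_lie_prod; [|rewrite -addnS]; apply: gr_chain.
by rewrite g_comm //; lia.
Qed.

Lemma chain_gr_lie i j : gr (q + (q + i + j))%N (lie (f i) (f j)).
Proof.
rewrite (_ : (q + (q + i + j) = (q + i) + (q + j))%N); last by lia.
by apply: gr_lie => //; apply: gr_chain.
Qed.

(* If the chain stopped after [f K], then [v = [f 0, f K]] would be central and
   [x], [v], [f 0], .., [f K] would span a finite-dimensional algebra. *)
Lemma chain_neq0 i : f i != 0.
Proof.
apply/negP => fi0.
have ex : exists i, f i == 0 by exists i.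
case: (ex_minnP ex) => -[|K] /eqP fK0 minK; first by case/eqP: y_neq0.
have f_neq0 j : (j <= K)%N -> f j != 0.
  by move=> jK; apply/negP => /minK; lia.
have K_ge2 : (2 <= K)%N.
  by rewrite leqNgt; apply/negP => K1; case/eqP: chain2_neq0; apply: chain_eq0_le fK0.
have f_eq0 j : (K < j)%N -> f j = 0 by move=> Kj; apply: chain_eq0_le fK0.
have fE j z : (j < K + q)%N -> gr (q + j)%N z -> exists a, z = a *: f j.
  by move=> jK; apply: (gr_chainE f_neq0 jK).
(* Degree [2q + K - 1] is the last one reached by [fE], and the spanning vector [f (q + K - 1)] lies
   past the end of the chain. *)
have lieKB i1 i2 : (i1 + i2)%N = K.-1 -> lie (f i1) (f i2) = 0.
  move=> iK; have [|a ->] := fE _ _ _ (chain_gr_lie i1 i2); first by lia.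
  by rewrite f_eq0 ?scaler0 //; lia.
pose v := lie (f 0) (f K).
have lieK i1 i2 : (i1 + i2)%N = K -> lie (f i1) (f i2) = (-1) ^+ i1 *: v.
  elim: i1 i2 => [|i1 IH] i2 iK; first by rewrite expr0 scale1r /v -iK.
  have := chain_leibniz i1 i2; rewrite lieKB ?lie0r; last by lia.
  move/esym/eqP; rewrite addr_eq0 => /eqP ->; rewrite IH; last by lia.
  by rewrite exprS mulN1r scaleNr.
(* Each use of the Leibniz rule adds one multiple of [[x, v]] up to sign. At [i1 = K + 1] the
   bracket is zero, so [(K + 1) [x, v] = 0], and characteristic zero gives [xv0]. *)
have lieKS i1 i2 : (i1 + i2)%N = K.+1 ->
    lie (f i1) (f i2) = (- ((-1) ^+ i1 * i1%:R)) *: lie x v.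
  elim: i1 i2 => [|i1 IH] i2 iK.
    by rewrite -iK add0n in fK0; rewrite fK0 lie0r mulr0 oppr0 scale0r.
  have := chain_leibniz i1 i2; rewrite lieK ?lieZr; last by lia.
  rewrite IH; last by lia.
  move=> vE; apply: (addIr (- ((-1) ^+ i1 * i1%:R) *: lie x v)).
  rewrite -vE -scalerDl.
  by congr (_ *: _); rewrite exprS -addn1 natrD; ring.
have xv0 : lie x v = 0.
  have := lieKS K.+1 0 (addn0 _); rewrite fK0 lie0l => /esym/eqP.
  rewrite scaler_eq0 oppr_eq0 mulf_eq0 signr_eq0 /=.
  by rewrite ((pcharf0P F).1 F_char0) /= => /eqP.
(* For [v = - [f 1, f (K - 1)]] the Leibniz rule leaves only the inner brackets [[y, f 1]] and
   [[y, f (K - 1)]], both zero. *)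
have yv0 : lie y v = 0.
  have -> : v = - lie (f 1) (f K.-1).
    by rewrite (lieK 1%N K.-1) ?expr1 ?scaleN1r ?opprK //; lia.
  rewrite lieNr -[y]/(f 0) lie_leibniz (lieKB 0%N K.-1) ?add0n // lie0r addr0.
  by rewrite chain_lie_near_diag // lie0l oppr0.
pose s := [:: x, v & [seq f j | j <- iota 0 K.+1]].
pose W := lspan [set` s].
have sW : subspace W := lspan_subspace _.
have Wx : W x by apply: subset_lspan; rewrite /= mem_head.
have Wv : W v by apply: subset_lspan; rewrite /= !inE eqxx orbT.
have Wf j : W (f j).
  have [Kj|jK] := ltnP K j; first by rewrite f_eq0 //; apply: subspace0.
  have fs : f j \in s by rewrite 2!in_cons map_f ?orbT // mem_iota.
  exact: (subset_lspan fs).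
have stab u : W (lie u x) -> W (lie u v) -> (forall j, W (lie u (f j))) ->
    forall w, W w -> W (lie u w).
  move=> ux uv uf.
  have us w : w \in s -> W (lie u w).
    by rewrite 2!in_cons => /or3P[/eqP ->|/eqP ->|/mapP[j _ ->]].
  apply: (@lspan_sub _ _ _ [set w | W (lie u w)]) => //.
  split=> [|a w1 w2 Ww1 Ww2] /=; first by rewrite lie0r; apply: subspace0.
  by rewrite lieDr lieZr; case: sW => _; apply.
apply: (g_infinite (s := s)); apply: (generated_ind g_gen) => //.
  by move=> u [/gr1E|/grqE] [a ->]; apply: (subspaceZ _ sW) => //; apply: (Wf 0%N).
move=> u w [/gr1E|/grqE] [a ->] Ww; rewrite lieZl; apply: (subspaceZ _ sW); move: w Ww;
  apply: stab.
- by rewrite liexx; apply: subspace0.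
- by rewrite xv0; apply: subspace0.
- by move=> j; apply: (Wf j.+1).
- by rewrite lieC; apply: (subspaceN sW); apply: (Wf 1%N).
- by rewrite yv0; apply: subspace0.
move=> j; have [jK|] := ltnP j K.
  have [|a' ->] := fE _ _ _ (chain_gr_lie 0 j); first by lia.
  exact: (subspaceZ _ sW).
rewrite leq_eqVlt => /orP[/eqP <- //|Kj].
by rewrite f_eq0 // lie0r; apply: subspace0.
Qed.

Lemma gr_qE i z : gr (q + i)%N z -> exists a, z = a *: f i.
Proof.
by apply: (@gr_chainE i) => [j _|]; [apply: chain_neq0 | lia].
Qed.

(** Each component from degree [q] on is a line, so the brackets have coordinates [c], to which
    [structure_constants_eq0] applies; scalar identities are read off from multiples of a nonzero
    [f k]. *)
Lemma chain_abelian i j : lie (f i) (f j) = 0.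
Proof.
have /choice[c cP] : forall i, exists c : nat -> F,
    forall j, lie (f i) (f j) = c j *: f (q + i + j)%N.
  move=> k; suff /choice[d dP] : forall l, exists a : F,
    lie (f k) (f l) = a *: f (q + k + l)%N by exists d.
  by move=> l; apply/gr_qE/chain_gr_lie.
have f_inj k (a b : F) : a *: f k = b *: f k -> a = b.
  move/eqP; rewrite -subr_eq0 -scalerBl scaler_eq0 (negbTE (chain_neq0 k)) orbF.
  by rewrite subr_eq0 => /eqP.
suff c0 : c i j = 0 by rewrite cP c0 scale0r.
apply: (@structure_constants_eq0 _ q) => //; first by lia.
- by move=> k; apply: (f_inj (q + k + k)%N); rewrite -cP liexx scale0r.
- move=> k l; apply: (f_inj (q + k + l)%N); rewrite -cP scaleNr addnAC -cP; exact: lieC.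
- move=> k l; apply: (f_inj (q + k + l).+1); rewrite scalerDl.
  rewrite chainS -lieZr -cP chain_leibniz !cP.
  by rewrite addnS addSn addnS.
- move=> k l m; apply: (f_inj (q + (q + k + l) + m)%N).
  rewrite scale0r !scalerDl -!scalerA.
  have e1 : (q + (q + k + l) + m = q + (q + l + m) + k)%N by lia.
  have e2 : (q + (q + k + l) + m = q + (q + m + k) + l)%N by lia.
  rewrite -cP {1}e1 -cP {1}e2 -cP -!lieZl -!cP.
  (* The inner brackets stand on the left here and on the right in [lie_jacobi]; negating the whole
     sum exchanges the two forms. *)
  apply/eqP; rewrite -oppr_eq0 !opprD -!lieC; apply/eqP.
  exact: lie_jacobi.
by move=> k kq; apply: (f_inj (q + k + k.+1)%N); rewrite -cP scale0r chain_lie_near_diag.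
Qed.

(** * The basis [x, f_0, f_1, ...] and the isomorphism with [m_0^q] *)

Lemma basis_ind (W : set g) : subspace W -> W x -> (forall i, W (f i)) ->
  W = [set: g].
Proof.
move=> sW Wx Wf; apply: (gr_ind gr_sum) => // i z gz.
have [iq|qi] := ltnP i q; last first.
  rewrite -(subnKC qi) in gz; have [a ->] := gr_qE gz.
  exact: (subspaceZ _ sW (Wf _)).
have [i1|i1] := eqVneq i 1%N; last first.
  by rewrite (gr_gap _ iq gz); [apply: (subspace0 sW) | apply/eqP].
by rewrite i1 in gz; have [a ->] := gr1E gz; apply: (subspaceZ _ sW Wx).
Qed.

Lemma chain_coordinates : exists phi : {linear g -> m0 F q},
  [/\ bijective phi, phi x = m0_e F q 1 & forall i, phi (f i) = m0_e F q (q + i)].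
Proof.
have /choice[c1 c1P] : forall z, exists a, pr 1 z = a *: x.
  by move=> z; apply: gr1E; apply: gr_proj_in.
have /choice[cf cfP] : forall z, exists c : nat -> F, forall i, pr (q + i) z = c i *: f i.
  move=> z; suff /choice[c cP] : forall i, exists a, pr (q + i) z = a *: f i by exists c.
  by move=> i; apply: gr_qE; apply: gr_proj_in.
have x_inj (a b : F) : a *: x = b *: x -> a = b.
  move/eqP; rewrite -subr_eq0 -scalerBl scaler_eq0 (negbTE x_neq0) orbF.
  by rewrite subr_eq0 => /eqP.
have f_inj k (a b : F) : a *: f k = b *: f k -> a = b.
  move/eqP; rewrite -subr_eq0 -scalerBl scaler_eq0 (negbTE (chain_neq0 k)) orbF.
  by rewrite subr_eq0 => /eqP.
(* Since [f i] has degree [q + i], a bound on the degrees of [z] also bounds the indices [i], so the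
   truncated polynomial loses no coefficient. *)
pose phi z : m0 F q := (c1 z, \poly_(i < gr_bound gr_sum z) cf z i).
have phi2 z i : (phi z).2`_i = cf z i.
  rewrite coef_poly; case: ltnP => // zi; apply: (f_inj i).
  by rewrite -cfP gr_proj_bound ?scale0r //; lia.
have phi_lin : linear phi.
  move=> a u v; congr pair.
    by apply: x_inj; rewrite -c1P linearP /= !c1P scalerDl scalerA.
  apply/polyP => i; rewrite coefD coefZ !phi2; apply: (f_inj i).
  by rewrite -cfP linearP /= !cfP scalerDl scalerA.
pose phiL : {linear g -> m0 F q} := HB.pack_for {linear g -> m0 F q} phi
  (GRing.isLinear.Build F g (m0 F q) *:%R phi phi_lin).
have phix : phiL x = m0_e F q 1.
  congr pair; first by apply: x_inj; rewrite -c1P scale1r (gr_projid gr_sum gx).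
  apply/polyP => i; rewrite phi2 coef0; apply: (f_inj i).
  by rewrite -cfP scale0r (gr_projP gr_sum gx) //; lia.
have phif k : phiL (f k) = m0_e F q (q + k).
  rewrite m0_eE ?leq_addr //; last by lia.
  congr pair.
    by apply: x_inj; rewrite -c1P scale0r (gr_projP gr_sum (gr_chain k)) //; lia.
  apply/polyP => i; rewrite phi2 addKn coefXn; apply: (f_inj i).
  rewrite -cfP (gr_proj_gr gr_sum _ (gr_chain k)) eqn_add2l.
  by case: eqP => [->|_]; rewrite ?scale1r ?scale0r.
exists phiL; split=> //.
have phi_inj : injective phiL.
  move=> u v /eqP; rewrite -subr_eq0 -linearB => /eqP.
  set w := u - v => w0; apply/eqP; rewrite -subr_eq0 -/w; apply/eqP.
  apply: (gr_proj_eq0 (gr_sum := gr_sum)) => i.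
  have [iq|qi] := ltnP i q; last first.
    by rewrite -(subnKC qi) cfP -phi2 -[phi w]/(phiL w) w0 coef0 scale0r.
  have [->|i1] := eqVneq i 1%N; last by apply: gr_proj_gap => //; apply/eqP.
  by rewrite c1P -[c1 w]/(phiL w).1 w0 scale0r.
clearbody phiL.
have /choice[psi psiP] : forall p, exists z, phiL z = p.
  move=> p; have [a [n [c ->]]] := m0_e_span (ltac:(lia) : (1 < q)%N) p.
  exists (a *: x + \sum_(i < n) c i *: f i).
  rewrite linearP /= linear_sum phix; congr (_ + _).
  by apply: eq_bigr => i _; rewrite linearZ /= phif.
by exists psi => // z; apply: phi_inj; rewrite psiP.
Qed.

Lemma narrow_algebra_iso : graded_lie_iso gr (@m0_gr F q).
Proof.
have [phi [phi_bij phix phif]] := chain_coordinates.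
have q_gt1 : (1 < q)%N by lia.
exists phi; split=> // [u v|i].
  (* Bracket compatibility is linear in the second argument and, by [swap], symmetric, so it is
     checked on the basis in one slot and then in the other. *)
  have lie_sub z : subspace [set w | phi (lie z w) = lie (phi z) (phi w)].
    split=> /= [|a w1 w2 w1P w2P]; first by rewrite lie0r !linear0 lie0r.
    by rewrite lieDr lieZr !linearP /= lieDr lieZr w1P w2P.
  have swap z w : phi (lie z w) = lie (phi z) (phi w) ->
      phi (lie w z) = lie (phi w) (phi z).
    by move=> E; rewrite lieC linearN /= E -lieC.
  have xP w : phi (lie x w) = lie (phi x) (phi w).
    pose W := [set w | phi (lie x w) = lie (phi x) (phi w)].
    suff WT : W = [set: g] by have : W w by rewrite WT.
    apply: basis_ind => [||j]; first exact: lie_sub.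
      by rewrite /W /= !liexx linear0.
    by rewrite /W /= -chainS !phif phix m0_lie_e1 ?leq_addr // addnS.
  have fP j w : phi (lie (f j) w) = lie (phi (f j)) (phi w).
    pose W := [set w | phi (lie (f j) w) = lie (phi (f j)) (phi w)].
    suff WT : W = [set: g] by have : W w by rewrite WT.
    apply: basis_ind => [||k]; first exact: lie_sub.
      exact/swap/xP.
    by rewrite /W /= chain_abelian linear0 !phif m0_lie_e ?leq_addr.
  pose W := [set w | phi (lie u w) = lie (phi u) (phi w)].
  suff WT : W = [set: g] by have : W v by rewrite WT.
  apply: basis_ind => [||k]; first exact: lie_sub.
    exact/swap/xP.
  exact/swap/fP.
rewrite /m0_gr; case: ifPn => [i_supp|]; last first.
  rewrite negb_or -ltnNge => /andP[/eqP i1 iq]; rewrite g_supp //.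
  by rewrite image_set1 linear0.
have [z [gz zP phiz]] : exists z, [/\ gr i z, forall w, gr i w -> exists a, w = a *: z
    & phi z = m0_e F q i].
  case/orP: i_supp => [/eqP ->|qi]; first by exists x; split=> // w /gr1E.
  exists (f (i - q)); rewrite phif subnKC //; split=> // [|w gw].
    by rewrite -{1}(subnKC qi); apply: gr_chain.
  by apply: gr_qE; rewrite subnKC.
rewrite lspan1E; apply/seteqP; split=> [_ [w /zP[a ->] <-]|_ [a ->]].
  by exists a; rewrite linearZ /= phiz.
exists (a *: z); last by rewrite linearZ /= phiz.
by apply: subspaceZ => //; apply: gr_subspace.
Qed.

End NarrowAlgebra.

Theorem theorem3p9 (F : closedFieldType) (F_char0 : [pchar F] =i pred0)
    (q : nat) (q_gt2 : (2 < q)%N)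
    (g : lieAlgType F) (gr : nat -> set g)
    (g_graded : Ngrading gr)
    (g_supp : forall i : nat, i <> 1%N -> (i < q)%N -> gr i = [set 0])
    (g_infinite : infinite_dimensional g)
    (g_maxclass : maximal_class g)
    (g_gen : lie_generated (gr 1%N `|` gr q) = [set: g])
    (g1_neq0 : gr 1%N <> [set 0])
    (gq_neq0 : gr q <> [set 0])
    (gq2_neq0 : gr q.+2 <> [set 0])
    (g_comm : forall i : nat, (q <= i <= 2 * q)%N ->
       lie_prod (gr i) (gr i.+1) = [set 0]) :
  graded_lie_iso gr (@m0_gr F q).
Proof.
have gr_sum := Ngrading_sum g_graded.
have nonzero i : gr i <> [set 0] -> exists2 z, gr i z & z != 0.
  move=> gi; apply: contrapT => no_z; apply: gi; apply/seteqP; split=> [z gz|_ ->].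
    by apply/eqP/negPn/negP => z0; apply: no_z; exists z.
  exact: subspace0 (gr_subspace gr_sum i).
have [x gx x_neq0] := nonzero _ g1_neq0.
have [y gy y_neq0] := nonzero _ gq_neq0.
exact: (narrow_algebra_iso F_char0 q_gt2 g_graded g_supp g_infinite g_maxclass
  g_gen gq2_neq0 g_comm gx gy x_neq0 y_neq0).
Qed.
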